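(* Let $a,b,c>0$ with $a>b$, and put $f(t)=\sqrt{a\sin^2t+b\cos^2t}$ for $t\in\mathbb{R}/2\pi\mathbb{Z}$. For $\tau>0$ let $$J(t,\tau)=\frac{c\tau^2+f^2(t)(1+\tau^2)}{abc},\qquad \omega=f(t)\,d\tau\wedge dt .$$ Then the 1-form $h(t)\,dt$ satisfying the condition that, in the limit $\tau\to\infty$, $$d(J^{1/2})\wedge h(t)\,dt=\omega,$$ is uniquely defined. Explicitly, this holds for $$h(t)=\mathrm{const}\cdot\frac{f(t)}{\sqrt{c+f^2(t)}}=\mathrm{const}\cdot\sqrt{\frac{a\sin^2t+b\cos^2t}{c+a\sin^2t+b\cos^2t}}$$ with an appropriate constant factor (independent of $t$).
   Context: The equality ''in the limit $\tau\to\infty$'' of the 2-forms $d(J^{1/2})\wedge h(t)\,dt$ and $\omega$ in the $(t,\tau)$ variables means that the difference of their coefficients with respect to $d\tau\wedge dt$ tends to $0$ as $\tau\to\infty$, for each $t$. Background: $J$ and $\omega$ are the Joachimsthal integral and the area form on the space of time-like geodesics of the ellipsoid $\frac{x^2}{a}+\frac{y^2}{b}+\frac{z^2}{c}=1$ in Minkowski space with metric $dx^2+dy^2-dz^2$, written in the coordinates $t$ (position $(\sqrt a\cos t,\sqrt b\sin t,0)$ of the intersection of the geodesic with the equator) and $\tau=1/\sqrt{\tan^2\alpha-1}$ ($\alpha$ being the Euclidean angle of the geodesic with the equator); the null geodesics correspond to $\tau=\infty$, so $h(t)\,dt$ is a 1-form on the space of null geodesics. *)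

(* Defs.v *)
From Stdlib Require Import Reals.
From Coquelicot Require Import Coquelicot.
Open Scope R_scope.

(* Functions on the circle R/2piZ are represented by their 2pi-periodic lifts
   to R; forms on the (t,tau) cylinder are given by their coefficients. *)

Record form1 := Form1 { coef_dt : R -> R -> R; coef_dtau : R -> R -> R }.

(* A 2-form is represented by its coefficient with respect to dtau /\ dt. *)
Definition form2 := R -> R -> R.

Definition ext_d (g : R -> R -> R) : form1 :=
  Form1 (fun t tau => Derive (fun s => g s tau) t)
        (fun t tau => Derive (fun s => g t s) tau).

Definition wedge (p q : form1) : form2 := fun t tau =>
  coef_dtau p t tau * coef_dt q t tau - coef_dt p t tau * coef_dtau q t tau.

Definition form_dt (h : R -> R) : form1 :=
  Form1 (fun t _ => h t) (fun _ _ => 0).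

Definition eq_at_infinity (p q : form2) : Prop :=
  forall t, is_lim (fun tau => p t tau - q t tau) p_infty 0.

Definition periodic (h : R -> R) : Prop := forall t, h (t + 2 * PI) = h t.

Definition smooth (h : R -> R) : Prop := forall n t, ex_derive_n h n t.

Definition ell_f (a b t : R) : R := sqrt (a * sin t ^ 2 + b * cos t ^ 2).

(* Only the values on tau > 0 are meaningful; the formulas are total. *)
Definition ell_J (a b c t tau : R) : R :=
  (c * tau ^ 2 + ell_f a b t ^ 2 * (1 + tau ^ 2)) / (a * b * c).

Definition omega (a b : R) : form2 := fun t _ => ell_f a b t.

Definition limit_condition (a b c : R) (h : R -> R) : Prop :=
  eq_at_infinity
    (wedge (ext_d (fun t tau => sqrt (ell_J a b c t tau))) (form_dt h))
    (omega a b).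

(* Main.v *)
(** For every t, [J = p tau^2 + q] with [p = (c + f^2) / (abc)] and
    [q = f^2 / (abc)], so the tau-derivative of [sqrt J] tends to [sqrt p] as
    tau goes to infinity.  Wedging with [h dt] discards the t-derivative, hence
    the limit condition says exactly [sqrt p * h = f]: this determines [h]
    pointwise and gives the constant [sqrt (abc)]. *)

Require Import Defs.
From Stdlib Require Import Reals Lra.
From Coquelicot Require Import Coquelicot.
Open Scope R_scope.

(* Chosen to be closed under differentiation, which makes all its members
   smooth at once. *)
Inductive elementary : (R -> R) -> Prop :=
  | elem_const k : elementary (fun _ => k)
  | elem_sin : elementary sin
  | elem_cos : elementary cos
  | elem_plus f g :
      elementary f -> elementary g -> elementary (fun t => f t + g t)
  | elem_mult f g :
      elementary f -> elementary g -> elementary (fun t => f t * g t)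
  | elem_inv f :
      (forall t, 0 < f t) -> elementary f -> elementary (fun t => / f t)
  | elem_sqrt f :
      (forall t, 0 < f t) -> elementary f -> elementary (fun t => sqrt (f t)).

(** The usual rules express each derivative through sums, products and inverses of members. The only
    inverses that arise are those of [f * f] and [2 * sqrt f], and positivity of [f] passes to both,
    so [elem_inv] applies. *)
Lemma elementary_derive f :
  elementary f -> exists g, elementary g /\ forall t, is_derive f t (g t).
Proof.
induction 1 as [k | | | f g _ [f' [Ef' Df]] _ [g' [Eg' Dg]]
  | f g Ef [f' [Ef' Df]] Eg [g' [Eg' Dg]]
  | f f0 Ef [f' [Ef' Df]] | f f0 Ef [f' [Ef' Df]]].
- exists (fun _ => 0); split; [constructor|].
  intros t; apply (@is_derive_const R_AbsRing R_NormedModule).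
- exists cos; split; [constructor|]; intros t; apply is_derive_sin.
- exists (fun t => (-1) * sin t); split; [repeat constructor|].
  intros t; replace (-1 * sin t) with (- sin t) by ring; apply is_derive_cos.
- exists (fun t => f' t + g' t); split; [now constructor|].
  intros t; now apply (@is_derive_plus R_AbsRing R_NormedModule).
- exists (fun t => f' t * g t + f t * g' t); split.
  + now apply elem_plus; apply elem_mult.
  + intros t; apply (@is_derive_mult R_AbsRing); auto.
    intros; apply Rmult_comm.
- exists (fun t => (-1) * f' t * / (f t * f t)); split.
  + repeat apply elem_mult; auto; [apply elem_const|].
    apply (elem_inv (fun t => f t * f t)); [|now apply elem_mult].
    intros t; now apply Rmult_lt_0_compat.
  + intros t.
    replace (-1 * f' t * / (f t * f t)) with (- f' t / f t ^ 2)
      by (specialize (f0 t); field; lra).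
    apply is_derive_inv; [apply Df|]; specialize (f0 t); lra.
- exists (fun t => f' t * / (2 * sqrt (f t))); split.
  + apply elem_mult; auto.
    apply (elem_inv (fun t => 2 * sqrt (f t))).
    * intros t; apply Rmult_lt_0_compat; [lra|now apply sqrt_lt_R0].
    * apply elem_mult; [apply elem_const|now apply elem_sqrt].
  + intros t; now apply is_derive_sqrt.
Qed.

Lemma elementary_derive_n f n :
  elementary f -> exists g, elementary g /\ forall t, Derive_n f n t = g t.
Proof.
intros Ef; induction n as [|n [g [Eg Dg]]]; [now exists f|].
destruct (elementary_derive g Eg) as [g' [Eg' Dg']].
exists g'; split; [exact Eg'|]; intros t; simpl.
rewrite (Derive_ext _ g) by exact Dg.
now apply is_derive_unique.
Qed.

Lemma smooth_elementary f : elementary f -> smooth f.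
Proof.
(* [ex_derive_n] is [True] at order 0; at order [S n] it asks that the [n]-th derivative be
   differentiable. *)
intros Ef [|n] t; [exact I|]; simpl.
destruct (elementary_derive_n f n Ef) as [g [Eg Dg]].
destruct (elementary_derive g Eg) as [g' [_ Dg']].
exists (g' t); apply (is_derive_ext g); [now intros s; rewrite Dg|apply Dg'].
Qed.

(** For positive [x] the derivative is [p * x / sqrt (p * x ^ 2 + q)]. Cancelling [x] gives
    [p / sqrt (p + q / x ^ 2)], which tends to [p / sqrt p = sqrt p]. *)
Lemma is_lim_Derive_sqrt_quadratic p q :
  0 < p -> 0 <= q ->
  is_lim (fun x => Derive (fun s => sqrt (p * s ^ 2 + q)) x) p_infty (sqrt p).
Proof.
intros p0 q0.
assert (pos : forall x, 0 < x -> 0 < p * x ^ 2 + q).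
{ intros x x0; assert (0 < p * x ^ 2) by (apply Rmult_lt_0_compat; nra); lra. }
apply (is_lim_ext_loc (fun x => p * / sqrt (p + q * (/ x * / x)))).
(* The two functions are compared on [x > 0], where [sqrt (x ^ 2)] is [x]. *)
{ exists 0; intros x x0.
  symmetry; apply is_derive_unique.
  auto_derive; [now apply pos|].
  assert (ix : 0 < / x * / x)
    by (apply Rmult_lt_0_compat; now apply Rinv_0_lt_compat).
  assert (r0 : 0 < p + q * (/ x * / x)) by nra.
  replace (p * (x * (x * 1)) + q) with (x ^ 2 * (p + q * (/ x * / x)))
    by (field; lra).
  rewrite sqrt_mult, sqrt_pow2 by nra.
  assert (0 < sqrt (p + q * (/ x * / x))) by now apply sqrt_lt_R0.
  field; lra. }
assert (sp : 0 < sqrt p) by now apply sqrt_lt_R0.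
replace (Finite (sqrt p)) with (Rbar_mult p (/ sqrt p)).
2: { simpl; f_equal; rewrite <- (sqrt_sqrt p) at 1 by lra; field; lra. }
apply is_lim_scal_l.
apply (is_lim_comp_continuous (fun x => p + q * (/ x * / x))
         (fun y => / sqrt y) p_infty p).
- replace (Finite p) with (Finite (p + q * (0 * 0))) by (f_equal; ring).
  assert (iv : is_lim (fun x => / x) p_infty 0).
  { apply (is_lim_inv (fun x => x) p_infty p_infty); [apply is_lim_id|easy]. }
  apply is_lim_plus'; [apply is_lim_const|].
  apply (is_lim_scal_l _ q p_infty (Finite (0 * 0))).
  now apply (is_lim_mult _ _ _ 0 0).
(* Continuity of [/ sqrt y] at [y = p] follows from differentiability there, as [p] is positive. *)
- apply (@ex_derive_continuous R_AbsRing R_NormedModule).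
  auto_derive; split; [lra|split; [lra|easy]].
Qed.

Section Ellipsoid.

Variables a b c : R.
Hypotheses (a0 : 0 < a) (b0 : 0 < b) (c0 : 0 < c).

Let u t := a * sin t ^ 2 + b * cos t ^ 2.

Lemma ell_radicand_gt0 t : 0 < u t.
Proof.
unfold u; pose proof (sin2_cos2 t) as sc; unfold Rsqr in sc.
pose proof (pow2_ge_0 (sin t)); pose proof (pow2_ge_0 (cos t)).
(* The two squares sum to 1, so at least one of them is at least 1/2 and its term is positive. *)
destruct (Rle_lt_dec (1 / 2) (sin t ^ 2)); nra.
Qed.

Lemma ell_f_sqr t : ell_f a b t ^ 2 = u t.
Proof. apply pow2_sqrt, Rlt_le, ell_radicand_gt0. Qed.

Lemma ell_f_periodic : periodic (ell_f a b).
Proof.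
intros t; unfold ell_f.
now rewrite sin_plus, cos_plus, sin_2PI, cos_2PI, !Rmult_0_r, !Rmult_1_r,
  Rplus_0_r, Rminus_0_r.
Qed.

Lemma abc_gt0 : 0 < a * b * c.
Proof. repeat apply Rmult_lt_0_compat; assumption. Qed.

Lemma ell_f_ratio t :
  ell_f a b t / sqrt (c + ell_f a b t ^ 2) = sqrt (u t / (c + u t)).
Proof.
pose proof (ell_radicand_gt0 t).
rewrite ell_f_sqr, sqrt_div by lra; reflexivity.
Qed.

Lemma smooth_ell_ratio k :
  smooth (fun t => k * sqrt (u t / (c + u t))).
Proof.
assert (Eu : elementary u).
{ apply (elem_plus (fun t => a * sin t ^ 2) (fun t => b * cos t ^ 2));
  apply (elem_mult (fun _ => _) (fun t => _ ^ 2)); try apply elem_const;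
  (* A square unfolds to [x * (x * 1)], a product of elementary functions. *)
  repeat (apply (elem_mult (fun t => _ t)) || constructor). }
pose proof ell_radicand_gt0 as u0.
apply smooth_elementary, elem_mult; [apply elem_const|].
apply elem_sqrt.
- intros t; apply Rdiv_lt_0_compat; specialize (u0 t); lra.
- apply elem_mult; [exact Eu|].
  apply (elem_inv (fun t => c + u t)); [intros t; specialize (u0 t); lra|].
  apply (elem_plus (fun _ => c)); [apply elem_const|exact Eu].
Qed.

(** Finding the limit for an arbitrary [h] serves existence and uniqueness alike: both reduce to the
    vanishing of this one value. *)
Lemma is_lim_wedge_sub_omega h t :
  is_lim (fun tau =>
    wedge (ext_d (fun t tau => sqrt (ell_J a b c t tau))) (form_dt h) t tau
      - omega a b t tau)
    p_infty (sqrt ((c + u t) / (a * b * c)) * h t - ell_f a b t).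
Proof.
pose proof abc_gt0 as k0; pose proof (ell_radicand_gt0 t) as u0.
apply (is_lim_ext (fun tau =>
  Derive (fun s => sqrt ((c + u t) / (a * b * c) * s ^ 2 + u t / (a * b * c))) tau
    * h t - ell_f a b t)).
{ intros tau; unfold wedge, omega; simpl.
  rewrite Rmult_0_r, Rminus_0_r; do 2 f_equal.
  apply Derive_ext; intros s; f_equal; unfold ell_J; rewrite ell_f_sqr.
  field; lra. }
apply (is_lim_minus _ _ _ (sqrt ((c + u t) / (a * b * c)) * h t) (ell_f a b t));
  [|apply is_lim_const|reflexivity].
apply (is_lim_scal_r _ (h t) p_infty (Finite _)), is_lim_Derive_sqrt_quadratic.
- apply Rdiv_lt_0_compat; lra.
- apply Rlt_le, Rdiv_lt_0_compat; lra.
Qed.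

(** Limits are unique, so the condition holds at [t] exactly when the limit found above is 0. This
    equation is linear in [h t], with the nonzero coefficient
    [sqrt (c + u t) / sqrt (a * b * c)]. *)
Lemma limit_conditionP h :
  limit_condition a b c h <->
  forall t, h t = sqrt (a * b * c) * (ell_f a b t / sqrt (c + ell_f a b t ^ 2)).
Proof.
pose proof abc_gt0 as k0.
assert (E : forall t,
  sqrt ((c + u t) / (a * b * c)) * h t - ell_f a b t = 0 <->
  h t = sqrt (a * b * c) * (ell_f a b t / sqrt (c + ell_f a b t ^ 2))).
{ intros t; pose proof (ell_radicand_gt0 t) as u0.
  rewrite ell_f_sqr, sqrt_div by lra.
  assert (0 < sqrt (a * b * c)) by now apply sqrt_lt_R0.
  assert (0 < sqrt (c + u t)) by (apply sqrt_lt_R0; lra).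
  split; intros e.
  - replace (ell_f a b t) with (sqrt (c + u t) / sqrt (a * b * c) * h t) by lra.
    field; lra.
  - rewrite e; field; lra. }
split.
- intros H t; apply E.
  pose proof (is_lim_unique _ _ _ (H t)) as e.
  rewrite (is_lim_unique _ _ _ (is_lim_wedge_sub_omega h t)) in e.
  now injection e.
- intros H t; rewrite <- (proj2 (E t) (H t)); apply is_lim_wedge_sub_omega.
Qed.

End Ellipsoid.

Theorem mainTheorem4 (a b c : R) (ha : 0 < a) (hb : 0 < b) (hc : 0 < c)
    (hab : b < a) :
  exists h : R -> R,
    (smooth h /\ periodic h /\ limit_condition a b c h) /\
    (forall g : R -> R, periodic g -> limit_condition a b c g ->
       forall t, g t = h t) /\
    (exists C : R, forall t,
       h t = C * (ell_f a b t / sqrt (c + ell_f a b t ^ 2)) /\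
       h t = C * sqrt ((a * sin t ^ 2 + b * cos t ^ 2) /
                       (c + a * sin t ^ 2 + b * cos t ^ 2))).
Proof.
set (u t := a * sin t ^ 2 + b * cos t ^ 2).
(* The witness has the single-root form, for which smoothness was shown; [ell_f_ratio] converts it
   to the quotient form of [limit_conditionP]. *)
exists (fun t => sqrt (a * b * c) * sqrt (u t / (c + u t))).
repeat split.
- now apply smooth_ell_ratio.
- intros t; unfold u.
  now rewrite <- !ell_f_ratio, ell_f_periodic.
- apply limit_conditionP; auto.
  intros t; now rewrite ell_f_ratio.
- intros g _ Hg t; unfold u; rewrite <- ell_f_ratio by assumption.
  now apply limit_conditionP.
- exists (sqrt (a * b * c)); intros t; split.
  + now rewrite ell_f_ratio.
  + unfold u; now rewrite Rplus_assoc.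
Qed.
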